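(* Let $Q$ be the vehicle capacity and let $S$ be any set of customers whose demands are given by independent binomial random variables $\xi_i\sim\mathrm{Bin}(n_i,p)$, $i\in S$, sharing a common success probability $p$, with total expected value $\sum_{i\in S}n_ip\le Q$. Then $S$ respects the monotonicity condition.
   Context: There is a finite set of customers with independent random demands $\xi_i$, served by identical vehicles of capacity $Q>0$. Monotonicity condition: a set $S$ of customers respects the monotonicity condition (with respect to the capacity $Q$) if, for every pair $(a,b)\in S\times S$ with $a\ne b$ and every subset $\tilde S\subseteq S\setminus\{a,b\}$, the inequality $$\mathbb{P}\left(\tilde\xi+\xi_a\le lQ<\tilde\xi+\xi_a+\xi_b\right)\ \ge\ \mathbb{P}\left(\tilde\xi\le lQ<\tilde\xi+\xi_b\right),\qquad \tilde\xi=\sum_{i\in\tilde S}\xi_i,$$ holds for every positive integer $l$. $\mathrm{Bin}(n_i,p)$ is the distribution of the number of successes in $n_i$ independent trials with success probability $p$.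
   Formalization: The vehicle capacity Q is taken to be a positive integer; for non-integer Q the claim fails, e.g. Q = 1.9, p = 0.1, n_a = n_b = 1 and a third customer with n_c = 17, l = 1. *)

(* Defs.v *)
From HB Require Import structures.
From mathcomp Require Export all_boot all_order all_algebra.
From mathcomp Require Export all_classical all_reals all_analysis.

Set Implicit Arguments.
Unset Strict Implicit.
Unset Printing Implicit Defensive.

Import Order.TTheory GRing.Theory Num.Theory.

Local Open Scope classical_set_scope.
Local Open Scope ring_scope.

Section Demands.
Context {d : measure_display} {T : measurableType d} {R : realType}.
Variable P : probability T R.

(* Mutual independence of (X i)_{i in S}: the product rule over every finite
   subfamily J of S, hence strictly more than pairwise independence. *)
Definition mutually_independent (I : finType) (S : {set I})
    (X : I -> {RV P >-> R}) : Prop :=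
  forall (J : {set I}) (A : I -> set R), J \subset S ->
    (forall i, i \in J -> measurable (A i)) ->
    P (\bigcap_(i in [set` J]) (X i @^-1` A i)) =
    (\prod_(i in J) P (X i @^-1` A i))%E.

(* The library's binomial_prob is a measure on nat, whereas demands are
   real-valued: the law of X is its image under the embedding of nat in R.
   binomial_prob n p is a Dirac mass when p is outside [0, 1], so users must
   assume 0 <= p <= 1. *)
Definition binomially_distributed (X : {RV P >-> R}) (n : nat) (p : R) : Prop :=
  forall A : set R, measurable A ->
    distribution P X A = binomial_prob n p [set k : nat | A k%:R].

Definition demand (I : finType) (xi : I -> {RV P >-> R}) (U : {set I})
  (w : T) : R := \sum_(i in U) xi i w.

Definition monotonicity_condition (I : finType) (xi : I -> {RV P >-> R})
    (Q : R) (S : {set I}) : Prop :=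
  forall a b : I, a \in S -> b \in S -> a != b ->
  forall U : {set I}, U \subset S :\: [set a; b]%SET ->
  forall l : nat, (0 < l)%N ->
    (P [set w | (demand xi U w <= l%:R * Q
                 < demand xi U w + xi b w)%R]
     <=
     P [set w | (demand xi U w + xi a w <= l%:R * Q
                 < demand xi U w + xi a w + xi b w)%R])%E.

End Demands.

(* Main.v *)
(* A demand over U is Bin(N, p)-distributed with N the sum of the n_i, so with
   F_N its distribution function and K = lQ, the two probabilities to compare
   are F_N(K) - F_(N + n_b)(K) and F_(N + n_a)(K) - F_(N + n_a + n_b)(K).
   Since F_N(K) - F_(N + 1)(K) = p P(Bin(N, p) = K), it suffices that
   P(Bin(N, p) = K) is nondecreasing in N while the mean N p is at most K. *)
Require Import Defs.
From mathcomp Require Import ring lra.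

Set Implicit Arguments.
Unset Strict Implicit.
Unset Printing Implicit Defensive.

Import Order.TTheory GRing.Theory Num.Theory.

Local Open Scope ring_scope.

(** * Binomial masses: Pascal's recursion and growth in the number of trials *)

Lemma binomial_pmfS0 (R : realType) (n : nat) (p : R) :
  binomial_pmf n.+1 p 0 = (1 - p) * binomial_pmf n p 0.
Proof. by rewrite /binomial_pmf !bin0 !subn0 !expr0 !mul1r exprS. Qed.

Lemma binomial_pmfSS (R : realType) (n : nat) (p : R) (k : nat) :
  binomial_pmf n.+1 p k.+1
  = (1 - p) * binomial_pmf n p k.+1 + p * binomial_pmf n p k.
Proof.
rewrite /binomial_pmf /unstable.onem binS subSS mulrnDr; congr (_ + _).
(* For [n <= k] the truncated exponents [n - k] and [n - k.+1] are both 0, so the powers do not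
   match; the coefficient ['C(n, k.+1)] vanishes instead. *)
- have [kn|nk] := ltnP k n; last by rewrite bin_small ?mulr0n ?mulr0.
  by rewrite -(subnSK kn) !exprS; ring.
- by rewrite exprS -!mulrnAr mulrA.
Qed.

Lemma binomial_pmf_small (R : realType) (n : nat) (p : R) (k : nat) :
  (n < k)%N -> binomial_pmf n p k = 0.
Proof. by move=> nk; rewrite /binomial_pmf bin_small. Qed.

(* The ratio of consecutive masses is [(n + 1) (1 - p) / (n + 1 - k)], which is
   at least 1 as long as [(n + 1) p <= k]. *)
Lemma binomial_pmf_leS (R : realType) (n : nat) (p : R) (k : nat) :
  0 <= p <= 1 -> n.+1%:R * p <= k%:R ->
  binomial_pmf n p k <= binomial_pmf n.+1 p k.
Proof.
move=> p01 npk.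
have [nk|kn] := ltnP n k.
  by rewrite (binomial_pmf_small _ nk) binomial_pmf_ge0.
have kS : (k%:R : R) < n.+1%:R by rewrite ltr_nat ltnS.
(* Clearing the denominator of the ratio leaves n + 1 - k <= (n + 1)(1 - p), which is the hypothesis
   on the mean. *)
rewrite -(ler_pM2r (_ : 0 < n.+1%:R - k%:R :> R)) ?subr_gt0//.
have -> : binomial_pmf n.+1 p k * (n.+1%:R - k%:R)
          = binomial_pmf n p k * (n.+1%:R * (1 - p)).
  have h : ('C(n.+1, k)%:R * (n.+1%:R - k%:R) : R) = n.+1%:R * 'C(n, k)%:R.
    by rewrite -natrB ?(leqW kn)// -!natrM mulnC -mul_bin_down.
  rewrite /binomial_pmf /unstable.onem -mulr_natr -[in RHS]mulr_natr.
  by rewrite subSn// exprS -mulrA h; ring.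
by apply: ler_wpM2l; [exact: binomial_pmf_ge0|lra].
Qed.

Lemma binomial_pmf_homo (R : realType) (m n : nat) (p : R) (k : nat) :
  0 <= p <= 1 -> (m <= n)%N -> n%:R * p <= k%:R ->
  binomial_pmf m p k <= binomial_pmf n p k.
Proof.
move=> p01; elim: n => [|n IHn]; first by rewrite leqn0 => /eqP ->.
rewrite leq_eqVlt => /predU1P[->//|mn] npk.
apply: (le_trans _ (binomial_pmf_leS p01 npk)); apply: IHn => //.
apply: le_trans npk; rewrite ler_wpM2r ?ler_nat//.
by case/andP: p01.
Qed.

(** * The binomial distribution function and its differences *)

(* Conditioning on the last trial; [x] is real so that the shift [x - 1] needs
   no truncation. *)
Fixpoint binomial_cdf (R : realType) (n : nat) (p x : R) : R :=
  if n is n'.+1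
  then (1 - p) * binomial_cdf n' p x + p * binomial_cdf n' p (x - 1)
  else (0 <= x)%R%:R.

Lemma binomial_cdf_lt0 (R : realType) (n : nat) (p x : R) :
  x < 0 -> binomial_cdf n p x = 0.
Proof.
elim: n x => [|n IHn] x x0 /=; first by rewrite leNgt x0.
by rewrite !IHn ?mulr0 ?addr0//; lra.
Qed.

(** Convolution: condition on the number j of successes in the last m trials. *)
Lemma binomial_cdfD (R : realType) (n m : nat) (p x : R) :
  binomial_cdf (n + m) p x
  = \sum_(j < m.+1) binomial_pmf m p j * binomial_cdf n p (x - j%:R).
Proof.
elim: m x => [|m IHm] x.
  by rewrite addn0 big_ord1 subr0 /binomial_pmf bin0 !expr0 !mul1r.
rewrite addnS /= !IHm [in RHS]big_ord_recl binomial_pmfS0.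
(* Pascal's rule separates failure from success of the additional trial; a success shifts the index
   by one. *)
under [in RHS]eq_bigr do rewrite /= binomial_pmfSS mulrDl.
rewrite big_split /= addrA; congr (_ + _).
(* The extra top term is zero: m trials cannot give m + 1 successes. *)
- rewrite [in RHS]big_ord_recr /= (binomial_pmf_small _ (ltnSn m)) mulr0.
  rewrite mul0r addr0 big_ord_recl mulrDr mulr_sumr mulrA; congr (_ + _).
  by apply: eq_bigr => i _; rewrite mulrA.
- rewrite mulr_sumr; apply: eq_bigr => i _.
  by rewrite mulrA /bump /= natrD opprD addrA.
Qed.

(** Both sides obey the same Pascal recursion. This links the recursive [binomial_cdf] to the
    masses, seen as its jumps at the integers. *)
Lemma binomial_cdf_pmf (R : realType) (n : nat) (p : R) (k : nat) :
  binomial_cdf n p k%:R - binomial_cdf n p (k%:R - 1) = binomial_pmf n p k.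
Proof.
elim: n k => [|n IHn] [|k].
- by rewrite /= lexx sub0r oppr_ge0 ler10 subr0 /binomial_pmf !expr0 mul1r.
- rewrite /= -[k.+1%:R]natr1 addrK ler0n addr_ge0// subrr.
  by rewrite binomial_pmf_small.
- rewrite binomial_pmfS0 -IHn /=.
  rewrite (binomial_cdf_lt0 n p (x := 0 - 1 - 1)); last lra.
  rewrite (binomial_cdf_lt0 n p (x := 0 - 1)); last lra.
  ring.
- by rewrite binomial_pmfSS -!IHn /= -[k.+1%:R]natr1 addrK; ring.
Qed.

(** One more trial takes the count beyond k exactly when the first n trials give k and the new one
    succeeds. *)
Lemma binomial_cdf_subS (R : realType) (n : nat) (p : R) (k : nat) :
  binomial_cdf n p k%:R - binomial_cdf n.+1 p k%:R = p * binomial_pmf n p k.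
Proof. by rewrite -binomial_cdf_pmf /=; ring. Qed.

(** Each difference telescopes into b terms p P(Bin(N + j, p) = k), with N = n on the left and N = n
    + a on the right; the terms compare one by one by [binomial_pmf_homo]. *)
Lemma binomial_cdf_concave (R : realType) (n a b : nat) (p : R) (k : nat) :
  0 <= p <= 1 -> (n + a + b)%:R * p <= k%:R ->
  binomial_cdf n p k%:R - binomial_cdf (n + b) p k%:R
  <= binomial_cdf (n + a) p k%:R - binomial_cdf (n + a + b) p k%:R.
Proof.
move=> p01; have [p0 _] := andP p01.
elim: b => [|b IHb] npk; first by rewrite !addn0 !subrr.
have le_b : (n + a + b)%:R * p <= k%:R.
  by apply: le_trans npk; rewrite ler_wpM2r// ler_nat leq_add2l.
have telescope N : binomial_cdf N p k%:R - binomial_cdf (N + b.+1) p k%:R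
    = binomial_cdf N p k%:R - binomial_cdf (N + b) p k%:R
      + p * binomial_pmf (N + b) p k.
  by rewrite -binomial_cdf_subS addnS; ring.
rewrite !telescope; apply: lerD; first exact: IHb.
apply: ler_wpM2l => //; apply: binomial_pmf_homo => //.
by rewrite leq_add2r leq_addr.
Qed.

(** * From independent binomial demands to [binomial_cdf] *)

Section BinomialDemands.
Context {d : measure_display} {T : measurableType d} {R : realType}.
Variable P : probability T R.

Lemma binomially_distributed_atom (X : {RV P >-> R}) (n : nat) (p : R)
    (k : nat) :
  0 <= p <= 1 -> binomially_distributed X n p ->
  P (X @^-1` [set k%:R])%classic = (binomial_pmf n p k)%:E.
Proof.
move=> p01 /(_ _ (measurable_set1 k%:R)).
rewrite /distribution /pushforward => ->; rewrite /binomial_prob p01.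
have -> : [set j : nat | [set k%:R] (j%:R : R)]%classic = [set k]%classic.
  by apply/seteqP; split => j /= => [/eqP|->//]; rewrite eqr_nat => /eqP.
by rewrite esum_set1// lee_fin binomial_pmf_ge0.
Qed.

(** Demands are nonnegative only almost surely; this makes the event that an added customer lowers
    the load negligible. *)
Lemma binomially_distributed_lt0 (X : {RV P >-> R}) (n : nat) (p : R) :
  binomially_distributed X n p -> P [set w | X w < 0]%classic = 0%E.
Proof.
move=> /(_ _ (measurable_itv `]-oo, 0[)).
rewrite /distribution /pushforward.
rewrite (_ : [set k : nat | _]%classic = set0) ?measure0.
  by move=> <-; congr (P _); apply/seteqP; split => w /=; rewrite in_itv.
by rewrite -subset0 => k /=; rewrite in_itv /= ltrn0.
Qed.

Lemma binomially_distributed_total (X : {RV P >-> R}) (n : nat) (p : R)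
    (G : set T) :
  0 <= p <= 1 -> binomially_distributed X n p -> measurable G ->
  P G = (\sum_(k < n.+1) P (G `&` X @^-1` [set (k : nat)%:R])%classic)%E.
Proof.
move=> p01 X_bin mG.
pose F k := (X @^-1` [set (k : nat)%:R : R])%classic.
have mF k : measurable (F k) by exact: measurable_funPTI.
pose D := (\bigcup_(k < n.+1) F k)%classic.
have mD : measurable D by exact: bigcup_measurable.
(* The complement of [D] is the preimage of a set whose only natural numbers exceed n, and these
   have mass 0. *)
have PD : P (~` D)%classic = 0%E.
  pose A := (~` \bigcup_(k < n.+1) [set (k : nat)%:R : R])%classic.
  have -> : (~` D = X @^-1` A)%classic.
    by rewrite /D /A -preimage_setC preimage_bigcup.
  have mA : measurable A.
    apply: measurableC; apply: bigcup_measurable => k _.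
    exact: measurable_set1.
  have := X_bin _ mA; rewrite /distribution /pushforward => ->.
  rewrite /binomial_prob p01; apply: esum1 => k Ak.
  rewrite binomial_pmf_small// ltnNge; apply/negP => kn.
  by apply: Ak; exists k.
rewrite (measureDI P mG mD) [X in (X + _)%E](_ : _ = 0%E); last first.
  apply: (subset_measure0 _ _ _ PD) => [||w []//].
  - exact: measurableD.
  - exact: measurableC.
rewrite add0e setI_bigcupr bigcup_mkord.
rewrite (measure_bigsetU P (F := fun k => G `&` F k)%classic)//.
- by move=> k; exact: measurableI.
- apply/trivIsetP => i j _ _ ij; rewrite -subset0 => w [[_ Xi] [_]].
  by move: Xi; rewrite /F /= => -> /eqP; rewrite eqr_nat (negbTE ij).
Qed.

Lemma measurable_demand_le (I : finType) (xi : I -> {RV P >-> R}) (U : {set I})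
    (x : R) :
  measurable [set w | demand xi U w <= x]%classic.
Proof.
rewrite -[X in measurable X]setTI.
apply: measurable_fun_le => //.
have -> : demand xi U = fun w => \sum_(i <- enum U) xi i w.
  by apply/funext => w; rewrite /demand big_enum.
exact: measurable_sum.
Qed.

(* The event on [J] carries the independence through the induction: each
   removal of an element of [U] conditions on its value and moves it to [J]. *)
Lemma demand_indep_cdf (I : finType) (xi : I -> {RV P >-> R}) (S : {set I})
    (n : I -> nat) (p : R) (U J : {set I}) (A : I -> set R) (x : R) :
  0 <= p <= 1 -> mutually_independent S xi ->
  (forall i, i \in S -> binomially_distributed (xi i) (n i) p) ->
  U \subset S -> J \subset S -> [disjoint U & J] ->
  (forall i, measurable (A i)) ->
  P ([set w | demand xi U w <= x] `&`
     \bigcap_(i in [set` J]) (xi i @^-1` A i))%classic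
  = ((binomial_cdf (\sum_(i in U) n i)%N p x)%:E *
     P (\bigcap_(i in [set` J]) (xi i @^-1` A i))%classic)%E.
Proof.
move=> p01 xi_indep xi_bin.
have mE (K : {set I}) (B : I -> set R) : (forall i, measurable (B i)) ->
    measurable (\bigcap_(i in [set` K]) (xi i @^-1` B i))%classic.
  move=> mB; apply: fin_bigcap_measurable => // i _.
  exact: measurable_funPTI.
move: {2}#|U| (erefl #|U|) => m.
elim: m U J A x => [|m IHm] U J A x cardU US JS UJ mA.
  move/eqP: cardU; rewrite cards_eq0 => /eqP ->.
  rewrite /demand big_set0 /=.
  under eq_set do rewrite big_set0.
  case: (boolP (0 <= x)) => x0.
  - by rewrite set_true setTI mul1e.
  - by rewrite set_false set0I measure0 mul0e.
have /card_gt0P[a aU] : (0 < #|U|)%N by rewrite cardU.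
have aS := fintype.subsetP US _ aU.
have aJ : a \notin J by rewrite (disjointFr UJ aU).
(* [B k] pins [xi a] to the value k; since [a] is outside [J], the constraints [A] on [J] are
   kept. *)
pose B k i := if i == a then [set (k : nat)%:R : R]%classic else A i.
have mB k i : measurable (B k i) by rewrite /B; case: ifP.
have EB k : (\bigcap_(i in [set` a |: J]) (xi i @^-1` B k i) =
    xi a @^-1` [set k%:R] `&` \bigcap_(i in [set` J]) (xi i @^-1` A i))%classic.
  rewrite (_ : [set` a |: J] = a |` [set` J])%classic; last first.
    by apply/seteqP; split => i /=; rewrite !inE => /predU1P.
  rewrite bigcap_setU1 /B eqxx; congr (_ `&` _)%classic.
  apply: eq_bigcapr => i /= iJ; case: eqP => // ia.
  by rewrite -ia iJ in aJ.
rewrite (binomially_distributed_total p01 (xi_bin _ aS)); last first.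
  by apply: measurableI; [exact: measurable_demand_le|exact: mE].
(* Both sides are now sums over the value k of [xi a], to be matched term by term. *)
rewrite (big_setD1 a)//= addnC binomial_cdfD.
rewrite -[P (\bigcap_(i in _) _)%classic]fineK ?fin_num_measure//; last first.
  exact: mE.
rewrite -EFinM mulr_suml -sumEFin; apply: eq_bigr => k _.
rewrite mulrAC !EFinM fineK ?fin_num_measure//; last exact: mE.
(* Independence enters here: the mass at k is absorbed into the event on [a |: J]. *)
have -> : ((binomial_pmf (n a) p k)%:E *
    P (\bigcap_(i in [set` J]) (xi i @^-1` A i))%classic =
    P (\bigcap_(i in [set` a |: J]) (xi i @^-1` B k i))%classic)%E.
  rewrite -(binomially_distributed_atom _ p01 (xi_bin _ aS)).
  rewrite !xi_indep ?big_setU1//=; last first.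
    by rewrite finset.subUset finset.sub1set aS.
  congr (_ * _)%E; first by rewrite /B eqxx.
  apply: eq_bigr => i iJ; rewrite /B; case: eqP => // ia.
  by rewrite -ia iJ in aJ.
(* Given [xi a] = k, the demand over [U] is at most x exactly when that over [U :\ a] is at most x -
   k. *)
rewrite muleC -IHm//.
- congr (P _); rewrite EB setIAC -!setIA.
  rewrite [in RHS]setIA [in LHS]setIA.
  congr (_ `&` _)%classic; apply/seteqP.
  have demandU w : demand xi U w = xi a w + demand xi (U :\ a) w.
    by rewrite /demand (big_setD1 a).
  by split => w /=; rewrite demandU => -[? ?]; split=> //; lra.
- by move: cardU; rewrite (cardsD1 a) aU => -[].
- exact: fintype.subset_trans (subD1set _ _) US.
- by rewrite finset.subUset finset.sub1set aS.
- apply/pred0P => i /=; rewrite !inE; case: eqP => //= _.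
  by case: (boolP (i \in U)) => // iU; rewrite (disjointFr UJ iU).
Qed.

Lemma demand_cdf (I : finType) (xi : I -> {RV P >-> R}) (S : {set I})
    (n : I -> nat) (p : R) (U : {set I}) (x : R) :
  0 <= p <= 1 -> mutually_independent S xi ->
  (forall i, i \in S -> binomially_distributed (xi i) (n i) p) ->
  U \subset S ->
  P [set w | demand xi U w <= x]%classic
  = (binomial_cdf (\sum_(i in U) n i)%N p x)%:E.
Proof.
move=> p01 xi_indep xi_bin US.
have U0 : [disjoint U & (finset.set0 : {set I})].
  by rewrite finset.disjoints_subset finset.setC0 finset.subsetT.
have := demand_indep_cdf (A := fun=> setT) x p01 xi_indep xi_bin US
  (finset.sub0set _) U0 (fun=> measurableT).
rewrite (_ : \bigcap_(i in _) _ = setT)%classic ?setIT.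
  by rewrite probability_setT mule1.
by apply/seteqP; split => // w _ i _.
Qed.

(** The event is a difference of two sublevel sets, and the subtracted one lies in the other up to a
    null set, so the probabilities subtract. *)
Lemma demand_crossing (I : finType) (xi : I -> {RV P >-> R}) (S : {set I})
    (n : I -> nat) (p : R) (U : {set I}) (b : I) (x : R) :
  0 <= p <= 1 -> mutually_independent S xi ->
  (forall i, i \in S -> binomially_distributed (xi i) (n i) p) ->
  b |: U \subset S -> b \notin U ->
  P [set w | demand xi U w <= x < demand xi U w + xi b w]%classic
  = (binomial_cdf (\sum_(i in U) n i)%N p x
     - binomial_cdf (\sum_(i in U) n i + n b)%N p x)%:E.
Proof.
move=> p01 xi_indep xi_bin bUS bU.
have /andP[bS US] : (b \in S) && (U \subset S).
  by move: bUS; rewrite finset.subUset finset.sub1set.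
pose L V := [set w | demand xi V w <= x]%classic.
have mL V : measurable (L V) by exact: measurable_demand_le.
have demandU w : demand xi (b |: U) w = demand xi U w + xi b w.
  by rewrite /demand big_setU1//= addrC.
have -> : [set w | demand xi U w <= x < demand xi U w + xi b w]%classic
    = (L U `\` L (b |: U))%classic.
  apply/seteqP; split => w; rewrite /L /= demandU.
  + by move=> /andP[-> /lt_geF ->].
  + by move=> [-> /negP]; rewrite -ltNge.
have PLI : P (L U `&` L (b |: U))%classic = P (L (b |: U)).
  rewrite [RHS](measureDI P (mL _) (mL U)) setIC.
  rewrite [X in (X + _)%E](_ : _ = 0%E) ?add0e//.
  apply: (subset_measure0 _ _ _ (binomially_distributed_lt0 (xi_bin _ bS))).
  - exact: measurableD.
  - exact: (measurable_funPTI (xi b) (measurable_itv `]-oo, 0[)).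
  (* If adding [b] brings the load from above x to at most x, then [xi b] is negative. *)
  - by move=> w; rewrite /L /= demandU => -[+ /negP]; rewrite -ltNge; lra.
have : P (L U) = (P (L U `\` L (b |: U)) + P (L U `&` L (b |: U)))%classic%E.
  exact: measureDI.
rewrite PLI !(demand_cdf _ p01 xi_indep xi_bin)//.
rewrite big_setU1//= addnC => /eqP; rewrite -sube_eq ?fin_num_adde_defl//.
by move=> /eqP <-; rewrite EFinB.
Qed.

End BinomialDemands.

Theorem proposition6 (d : measure_display) (T : measurableType d)
    (R : realType) (P : probability T R)
    (I : finType) (xi : I -> {RV P >-> R}) (S : {set I})
    (Q : nat) (Q_gt0 : (0 < Q)%N)
    (n : I -> nat) (p : R) (p01 : 0 <= p <= 1)
    (xi_indep : mutually_independent S xi)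
    (xi_bin : forall i, i \in S -> binomially_distributed (xi i) (n i) p)
    (mean_le : \sum_(i in S) (n i)%:R * p <= Q%:R) :
  monotonicity_condition xi Q%:R S.
Proof.
move=> a b aS bS ab U USab l l_gt0.
have /andP[US /andP[aU bU]] : [&& U \subset S, a \notin U & b \notin U].
  have US : U \subset S by exact: fintype.subset_trans USab (subsetDl _ _).
  rewrite US /=; apply/andP; split; apply/negP.
  - by move=> /(fintype.subsetP USab); rewrite !inE eqxx.
  - by move=> /(fintype.subsetP USab); rewrite !inE eqxx orbT.
have abU : b \notin a |: U by rewrite !inE negb_or eq_sym ab.
have abUS : b |: (a |: U) \subset S.
  by rewrite !finset.subUset !finset.sub1set aS bS.
have bUS : b |: U \subset S by rewrite finset.subUset finset.sub1set bS.
have demandU w : demand xi (a |: U) w = demand xi U w + xi a w.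
  by rewrite /demand big_setU1//= addrC.
(* The threshold lQ becomes the image of a natural number, as [binomial_cdf_concave] requires. *)
rewrite -natrM; under [X in (_ <= P X)%E]eq_set do rewrite -demandU.
rewrite !(demand_crossing _ p01 xi_indep xi_bin)// lee_fin.
rewrite big_setU1//= [(n a + _)%N]addnC.
apply: binomial_cdf_concave => //.
(* All trials involved belong to customers of [S], so their mean is at most Q, hence at most lQ
   because l >= 1. *)
have -> : (\sum_(i in U) n i + n a + n b = \sum_(i in b |: (a |: U)) n i)%N.
  by rewrite !big_setU1//= addnC [(n a + _)%N]addnC.
apply: (@le_trans _ _ Q%:R); last by rewrite ler_nat leq_pmull.
apply: le_trans mean_le; rewrite -mulr_suml -natr_sum.
case/andP: p01 => p0 _; apply: ler_wpM2r => //; rewrite ler_nat.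
rewrite [leqRHS](big_setID (b |: (a |: U)))/=.
by rewrite (finset.setIidPr abUS) leq_addr.
Qed.
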